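(* Let $E=(X,d)$ be a geodesic metric space of diameter $2$ with a starting point $O\in X$. Then: (i) for every $n\ge1$, $GR_0$ is optimal for $\mathcal I_{n,0}(E)$ and $\gamma^{\mathcal I_{n,0}(E)}=\frac1n$; (ii) for every $n\ge1$ and $0\le T<\frac1{2^{n-3}+1}$, $\lambda^{\mathcal I_{n,T}(E)}=\frac1n$; (iii) for every $n\ge3$ and $0\le T<\frac1{2^{n-1}-2}$, $GR_0$ is optimal for $\mathcal I_{n,T}(E)$ and $\gamma^{\mathcal I_{n,T}(E)}=\frac1n$.
   Context: A metric space $(X,d)$ is geodesic if for any $a,b\in X$ there is a continuous path from $a$ to $b$ whose range is isometric to $[0,d(a,b)]$; its diameter is $\sup_{x,y}d(x,y)$ (not necessarily attained). Problem (OPTiWinD on $E$): a vehicle starts at $O$ at time $0$ and moves in $X$ at speed at most $1$. A request is a triple $(A,[r,r+2],\delta)$ with $A\in X$, release time $r\ge0$, weight $\delta>0$; it is served if the vehicle is at $A$ at some time in $[r,r+2]$. $\mathcal I_{n,T}(E)$ is the set of instances with at most $n$ requests such that successive release times differ by at least $T$. An online algorithm learns each request only at its release time and does not know the number of requests in advance. Performance $\lambda^I_{ALG}$ = served weight/total weight; $OPT$ is the optimal offline algorithm; $\lambda^{\mathcal I}_{ALG}=\inf_{I\in\mathcal I}\lambda^I_{ALG}$, $\gamma^{\mathcal I}_{ALG}=\inf_{I\in\mathcal I}\lambda^I_{ALG}/\lambda^I_{OPT}$, $\lambda^{\mathcal I}=\sup_{ALG}\lambda^{\mathcal I}_{ALG}$,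 $\gamma^{\mathcal I}=\sup_{ALG}\gamma^{\mathcal I}_{ALG}$ over online algorithms; an online algorithm is optimal if its competitive ratio equals $\gamma^{\mathcal I}$. $GR_0$: the vehicle always moves at unit speed along a shortest path towards the request of greatest weight among released, not yet served requests whose window is still open. *)

(* Defs.v *)
From HB Require Import structures.
From mathcomp Require Import all_boot all_order all_algebra.
From mathcomp Require Import all_classical all_reals all_analysis.

Set Implicit Arguments.
Unset Strict Implicit.
Unset Printing Implicit Defensive.

Import Order.TTheory GRing.Theory Num.Theory.
Import numFieldNormedType.Exports.

Local Open Scope classical_set_scope.
Local Open Scope ring_scope.

Section MetricSpaces.
Context {R : realType} (X : metricType R).

Definition isometry_on (l : R) (g : R -> X) : Prop :=
  forall s t, 0 <= s <= l -> 0 <= t <= l -> mdist (g s) (g t) = `|s - t|.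

Definition geodesic_space : Prop :=
  forall a b : X, exists g : R -> X,
    [/\ {within `[0, 1], continuous g}, g 0 = a, g 1 = b &
        exists2 h : R -> X, isometry_on (mdist a b) h &
          h @` `[0, mdist a b] = g @` `[0, 1]].

Definition diameter : \bar R :=
  ereal_sup [set (mdist x y)%:E | x in [set: X] & y in [set: X]].

(* Parametrized by arc length. *)
Definition shortest_path (g : R -> X) (a b : X) : Prop :=
  [/\ g 0 = a, g (mdist a b) = b & isometry_on (mdist a b) g].

End MetricSpaces.

(* The request (A, [r, r + 2], delta). *)
Record request {R : realType} (X : metricType R) : Type := Request {
  site : X;
  release : R;
  weight : R
}.

Section OPTiWinD.
Context {R : realType} {X : metricType R}.
Implicit Types (O a : X) (q : request X) (f : R -> X) (n : nat) (T s t : R).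

(* A finite sequence of requests, in order of release; repeated and
   simultaneous requests are allowed. *)
Definition is_instance (I : seq (request X)) : Prop :=
  all (fun q => (0 <= release q) && (0 < weight q)) I /\
  sorted (fun q q' => release q <= release q') I.

(* The empty instance, whose performance would be 0 / 0, is left out. *)
Definition instances n T : set (seq (request X)) :=
  [set I | [/\ is_instance I, (0 < size I <= n)%N &
             sorted (fun q q' => T <= release q' - release q) I]].

(* Motion of a vehicle; only its values at times t >= 0 are meaningful. *)
Definition trajectory O f : Prop :=
  f 0 = O /\ forall s t, 0 <= s -> s <= t -> mdist (f s) (f t) <= t - s.

Definition served q f : Prop :=
  exists2 t, release q <= t <= release q + 2 & f t = site q.

(* lambda^I of an algorithm whose vehicle follows f on the instance I. *)
Definition performance (I : seq (request X)) f : R :=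
  (\sum_(q <- I | `[< served q f >]) weight q) / (\sum_(q <- I) weight q).

Definition opt_performance O (I : seq (request X)) : R :=
  sup [set performance I f | f in [set f | trajectory O f]].

Definition algorithm : Type := seq (request X) -> R -> X.

Definition released (I : seq (request X)) t : seq (request X) :=
  [seq q <- I | release q <= t].

(* The number of requests still to come is unknown: the position at time t must
   agree on all instances, of any length, with the same requests up to t. *)
Definition online O (A : algorithm) : Prop :=
  (forall I, is_instance I -> trajectory O (A I)) /\
  (forall I J t, is_instance I -> is_instance J -> 0 <= t ->
     released I t = released J t -> A I t = A J t).

Definition alg_lambda (C : set (seq (request X))) (A : algorithm) : R :=
  inf [set performance I (A I) | I in C].

Definition alg_gamma O (C : set (seq (request X))) (A : algorithm) : R :=
  inf [set performance I (A I) / opt_performance O I | I in C].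

Definition lambda O (C : set (seq (request X))) : R :=
  sup [set alg_lambda C A | A in [set A | online O A]].

Definition gamma O (C : set (seq (request X))) : R :=
  sup [set alg_gamma O C A | A in [set A | online O A]].

Definition optimal O (C : set (seq (request X))) (A : algorithm) : Prop :=
  online O A /\ alg_gamma O C A = gamma O C.

Definition pending q f t : Prop :=
  release q <= t <= release q + 2 /\
  forall s, release q <= s <= t -> f s <> site q.

Definition req (I : seq (request X)) (i : 'I_(size I)) : request X :=
  tnth (in_tuple I) i.

Definition heaviest_pending (I : seq (request X)) f t (i : 'I_(size I)) : Prop :=
  pending (req i) f t /\
  forall j : 'I_(size I), pending (req j) f t -> weight (req j) <= weight (req i).

(* From time s to time t, at unit speed along a shortest path towards a. *)
Definition moves_towards f s t a : Prop :=
  exists2 g, shortest_path g (f s) a & forall u, s <= u <= t -> f u = g (u - s).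

(* The vehicle rests while no request is pending. Ties between requests of equal
   weight are broken arbitrarily, but a target is kept for as long as it remains
   a heaviest pending request (third clause); otherwise the vehicle could
   oscillate between tied requests and serve none. Targets are held on
   half-open intervals [s, t), since a new target may be chosen at t. *)
Definition GR0_run (I : seq (request X)) f : Prop :=
  exists target : R -> option 'I_(size I),
  [/\ forall t i, 0 <= t -> target t = Some i -> heaviest_pending f t i,
      forall t (i : 'I_(size I)), 0 <= t -> target t = None ->
        ~ pending (req i) f t,
      forall s t i, 0 <= s -> s <= t -> target s = Some i ->
        (forall u, s <= u <= t -> heaviest_pending f u i) -> target t = Some i,
      forall s t i, 0 <= s -> s <= t ->
        (forall u, s <= u < t -> target u = Some i) ->
        moves_towards f s t (site (req i)) &
      forall s t, 0 <= s -> s <= t ->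
        (forall u, s <= u < t -> target u = None) -> f t = f s].

Definition is_GR0 O (A : algorithm) : Prop :=
  online O A /\ forall I, is_instance I -> GR0_run I (A I).

(* GR_0 is determined only up to the choice of shortest paths and the breaking of
   ties: it exists, and is optimal for all such choices. *)
Definition GR0_optimal O (C : set (seq (request X))) : Prop :=
  (exists A, is_GR0 O A) /\ (forall A, is_GR0 O A -> optimal O C A).

End OPTiWinD.

(* Main.v *)
(* Upper bound: let a, b be sites at distance almost 2. All requests have weight 1
   and site a or b, and at any time at most one of them, at x say, is still within
   reach of the online vehicle. The adversary waits until the vehicle is at a
   prescribed distance D from x, then releases a request at the other site y, and
   waits (at least T) until x or y has become unreachable; the remaining distance
   is then at least about min(D/2, D - T), whence D = T 2^(k-2) when k requests are
   still to come. If the vehicle never comes that close to x, everything is lost and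
   the adversary starts afresh. So one request at most is served online. Offline,
   a vehicle can move in phase opposition between a and b; each turn delays it by at
   most the sum of two consecutive D's, and it serves everything as long as
   T (2^(n-1) - 2) < 1.

   Lower bound: once GR_0 aims at a heaviest request it reaches it within time 2.
   Its existence: let the target be the heaviest pending request, the first one in
   the case of a tie; the path is built by going through the requests in this
   order after each release. *)

Require Import Defs.
From HB Require Import structures.
From mathcomp Require Import all_boot all_order all_algebra.
From mathcomp Require Import all_classical all_reals all_analysis.
From mathcomp Require Import lra ring zify.

Import Order.TTheory GRing.Theory Num.Theory.
Import numFieldNormedType.Exports.

Local Open Scope classical_set_scope.
Local Open Scope ring_scope.

Set Implicit Arguments.
Unset Strict Implicit.
Unset Printing Implicit Defensive.

(** The witness is the supremum of the [s] up to which [h] stays at most [c]; the Lipschitz bound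
    excludes both a smaller and a larger value of [h] there. *)
Lemma first_hit {R : realType} (h : R -> R) (K x y c : R) : 0 < K -> x <= y ->
  (forall s t, x <= s -> s <= t -> t <= y -> `|h t - h s| <= K * (t - s)) ->
  h x <= c -> c <= h y ->
  exists s, [/\ x <= s <= y, h s = c & forall u, x <= u <= s -> h u <= c].
Proof.
move=> K0 xy lip hxc chy.
pose E := [set s | x <= s <= y /\ forall u, x <= u <= s -> h u <= c].
have Ex : E x.
  split=> [|u /andP[xu ux]]; first by rewrite lexx.
  by rewrite (_ : u = x) //; apply/eqP; rewrite eq_le ux.
have ubE : has_ubound E by exists y => s [/andP[_ ?] _].
have xS : x <= sup E by exact: ub_le_sup.
have Sy : sup E <= y by apply: ge_sup; [exists x | move=> s [/andP[_ ?] _]].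
have below u : x <= u -> u < sup E -> h u <= c.
  move=> xu uS; have [|e [_ He] ue] := sup_gt _ uS; first by exists x.
  by apply: He; rewrite xu ltW.
have K2 : 0 < 2 * K by rewrite mulr_gt0.
have hSc : h (sup E) <= c.
  rewrite leNgt; apply/negP => cS.
  have xltS : x < sup E.
    by rewrite lt_neqAle xS andbT; apply/eqP => e; move: cS; rewrite -e ltNge hxc.
  pose d := (h (sup E) - c) / (2 * K).
  have d0 : 0 < d by rewrite divr_gt0// subr_gt0.
  have Kd : K * d = (h (sup E) - c) / 2 by rewrite /d; field; rewrite gt_eqF.
  pose u := Num.max x (sup E - d).
  have uS : u < sup E by rewrite gt_max xltS /=; lra.
  have xu : x <= u by rewrite le_max lexx.
  have Su : sup E - u <= d by have : sup E - d <= u; [rewrite le_max lexx orbT | lra].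
  have := below u xu uS; have := lip u (sup E) xu (ltW uS) Sy.
  have : K * (sup E - u) <= K * d by rewrite ler_pM2l.
  by have := ler_norm (h (sup E) - h u); lra.
have chS : c <= h (sup E).
  rewrite leNgt; apply/negP => Sc.
  have Slty : sup E < y.
    by rewrite lt_neqAle Sy andbT; apply/eqP => e; move: Sc; rewrite e ltNge chy.
  pose d := (c - h (sup E)) / (2 * K).
  have d0 : 0 < d by rewrite divr_gt0// subr_gt0.
  have Kd : K * d = (c - h (sup E)) / 2 by rewrite /d; field; rewrite gt_eqF.
  pose u := Num.min y (sup E + d).
  have Su : sup E < u by rewrite lt_min Slty /=; lra.
  have uy : u <= y by rewrite ge_min lexx.
  have ud : u <= sup E + d by rewrite ge_min lexx orbT.
  suff : E u by move=> /(ub_le_sup ubE); rewrite leNgt Su.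
  split=> [|v /andP[xv vu]]; first by rewrite (le_trans xS (ltW Su)).
  have [vS|Sv] := ltP v (sup E); first exact: below.
  have := lip (sup E) v xS Sv (le_trans vu uy).
  have : K * (v - sup E) <= K * d by rewrite ler_pM2l//; lra.
  by have := ler_norm (h v - h (sup E)); lra.
exists (sup E); split; first by rewrite xS.
  by apply/eqP; rewrite eq_le hSc.
move=> u /andP[xu]; rewrite le_eqVlt => /orP[/eqP->//|]; exact: below.
Qed.

(** * Geodesics and motions at speed at most one *)

Section Geodesics.
Context {R : realType} {X : metricType R}.
Implicit Types (O a b x y : X) (f g : R -> X).

Lemma diameter_le d : diameter X = d%:E -> forall x y, mdist x y <= d.
Proof.
move=> dX x y; rewrite -lee_fin -dX; apply: ereal_sup_ubound.
by exists x => //; exists y.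
Qed.

Lemma diameter_gt d e : diameter X = d%:E -> e < d -> exists x y : X, e < mdist x y.
Proof.
move=> dX ed; have : (e%:E < diameter X)%E by rewrite dX lte_fin.
by move=> /ereal_sup_gt[_ [x _ [y _ <-]]]; rewrite lte_fin; exists x, y.
Qed.

(** Only the range of the isometry [h] is tied to [a] and [b]. Their parameters lie at distance [l]
    in [[0, l]], so they are its two ends; in the wrong order, [h] is run backwards. *)
Lemma shortest_path_ex : geodesic_space X ->
  forall a b, exists g, shortest_path g a b.
Proof.
move=> gX a b; have [g [_ g0 g1 [h iso im]]] := gX a b.
set l := mdist a b in iso im *; have l0 : 0 <= l by exact: mdist_ge0.
have [s /= sl ha] : (h @` `[0, l]) a.
  by rewrite im; exists 0 => //=; rewrite in_itv /= lexx ler01.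
have [t /= tl hb] : (h @` `[0, l]) b.
  by rewrite im; exists 1 => //=; rewrite in_itv /= lexx ler01.
rewrite !in_itv /= in sl tl.
have := iso s t sl tl; rewrite ha hb -/l => lst.
have [st|ts] := lerP s t.
  have [es et] : s = 0 /\ t = l by move: lst; rewrite ler0_norm; lra.
  by exists h; split; rewrite -/l -?ha -?hb ?es ?et.
have [es et] : s = l /\ t = 0 by move: lst; rewrite ger0_norm; lra.
exists (fun u => h (l - u)); split; rewrite -/l ?subr0 ?subrr -?ha -?hb ?es ?et//.
move=> u v ul vl; rewrite iso; [|lra|lra].
by rewrite distrC; congr (`|_|); ring.
Qed.

Lemma trajectory_lip O f s t :
  trajectory O f -> 0 <= s -> s <= t -> mdist (f s) (f t) <= t - s.
Proof. by move=> [_]; apply. Qed.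

Lemma trajectory_dist O f x s t : trajectory O f -> 0 <= s -> s <= t ->
  mdist (f s) x <= (t - s) + mdist (f t) x.
Proof.
move=> tf s0 st; have := trajectory_lip tf s0 st.
by have := metric_triangle (f s) (f t) x; lra.
Qed.

Lemma trajectory_dist' O f x s t : trajectory O f -> 0 <= s -> s <= t ->
  mdist (f t) x <= (t - s) + mdist (f s) x.
Proof.
move=> tf s0 st; have := trajectory_lip tf s0 st; rewrite metric_sym.
by have := metric_triangle (f t) (f s) x; lra.
Qed.

Lemma trajectory_cst O : trajectory O (fun _ => O).
Proof. by split=> // s t _ st; rewrite mdistxx; lra. Qed.

Lemma trajectory_glue O f g e : 0 <= e -> trajectory O f -> f e = g e ->
  (forall s t, e <= s -> s <= t -> mdist (g s) (g t) <= t - s) ->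
  trajectory O (fun s => if s <= e then f s else g s).
Proof.
move=> e0 tf fge lg; split=> [|s t s0 st]; first by rewrite e0; case: tf.
have [te|et] := leP t e.
  by rewrite (le_trans st te); exact: trajectory_lip tf s0 st.
have [se|es] := leP s e; last by apply: lg; lra.
have := trajectory_lip tf s0 se; have := lg e t (lexx e) (ltW et).
by have := metric_triangle (f s) (f e) (g t); rewrite fge; lra.
Qed.

Lemma trajectory_freeze O f e : 0 <= e -> trajectory O f ->
  trajectory O (fun s => if s <= e then f s else f e).
Proof. by move=> e0 tf; apply: trajectory_glue => // s t _ st; rewrite mdistxx; lra. Qed.

Lemma trajectory_goto O f e y : geodesic_space X -> 0 <= e -> trajectory O f ->
  exists h, [/\ trajectory O h, forall s, s <= e -> h s = f s &
    forall s, e + mdist (f e) y <= s -> h s = y].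
Proof.
move=> gX e0 tf; have [g [g0 g1 iso]] := shortest_path_ex gX (f e) y.
set d := mdist (f e) y in g1 iso *; have d0 : 0 <= d by exact: mdist_ge0.
pose p s := g (Num.min (s - e) d).
exists (fun s => if s <= e then f s else p s); split.
- apply: trajectory_glue => //; first by rewrite /p subrr min_l ?g0.
  move=> s t es st; rewrite /p iso.
  + by rewrite ler_norml; case: (leP (s - e) d); case: (leP (t - e) d); lra.
  + by case: (leP (s - e) d); lra.
  + by case: (leP (t - e) d); lra.
- by move=> s ->.
- move=> s des; have [se|es] := leP s e; last by rewrite /p min_r ?g1//; lra.
  have de : d = 0 by lra.
  have se' : s = e by lra.
  by rewrite se'; apply: mdist_positivity; rewrite -/d.
Qed.

(* The triangle inequality forces a 1-Lipschitz curve which comes closer to [a]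
   at unit rate to be isometric, hence a shortest path. *)
Lemma straight_moves O f s t a : geodesic_space X -> trajectory O f ->
  0 <= s -> s <= t -> mdist (f s) a = (t - s) + mdist (f t) a ->
  moves_towards f s t a.
Proof.
move=> gX tf s0 st str.
have [g [g0 g1 iso]] := shortest_path_ex gX (f t) a.
(* The piece of [f] between [s] and [t], prolonged by a shortest path from [f t] to [a]; the total
   length is [mdist (f s) a]. *)
pose G v := if v <= t - s then f (s + v) else g (v - (t - s)).
have fL u v : 0 <= u -> u <= v -> v <= t - s -> mdist (f (s + u)) (f (s + v)) = v - u.
  move=> u0 uv vt.
  have h1 : mdist (f (s + u)) (f (s + v)) <= s + v - (s + u).
    by apply: trajectory_lip tf _ _; lra.
  have h2 : mdist (f s) a <= s + u - s + mdist (f (s + u)) a.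
    by apply: trajectory_dist tf _ _; lra.
  have h3 : mdist (f (s + v)) a <= t - (s + v) + mdist (f t) a.
    by apply: trajectory_dist tf _ _; lra.
  have h4 := metric_triangle (f (s + u)) (f (s + v)) a.
  by apply/eqP; rewrite eq_le; apply/andP; split; lra.
have mono u v : 0 <= u -> u <= v -> v <= mdist (f s) a -> mdist (G u) (G v) = v - u.
  move=> u0 uv va; rewrite /G.
  have [vt|tv] := leP v (t - s); first by rewrite (le_trans uv vt) fL.
  have [ut|tu] := leP u (t - s); last first.
    by rewrite iso; [rewrite ler0_norm; lra | lra | lra].
  have h1 : mdist (f (s + u)) (f t) = t - s - u.
    by have := fL u (t - s) u0 ut (lexx _); rewrite subrKC.
  have h2 : mdist (f t) (g (v - (t - s))) = v - (t - s).
    by rewrite -[in LHS]g0 iso; [rewrite ler0_norm; lra | lra | lra].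
  have h3 : mdist (g (v - (t - s))) a = mdist (f t) a - (v - (t - s)).
    by rewrite -[in LHS]g1 iso; [rewrite ler0_norm; lra | lra | have := mdist_ge0 (f t) a; lra].
  have h4 := metric_triangle (f (s + u)) (f t) (g (v - (t - s))).
  have h5 := metric_triangle (f (s + u)) (g (v - (t - s))) a.
  have h6 : mdist (f s) a <= s + u - s + mdist (f (s + u)) a.
    by apply: trajectory_dist tf _ _; lra.
  by apply/eqP; rewrite eq_le; apply/andP; split; lra.
exists G; last by move=> u /andP[su ut]; rewrite /G ifT; [rewrite subrKC | lra].
split.
- by rewrite /G ifT ?addr0//; lra.
- rewrite /G; case: leP => [le|lt]; last by rewrite str addrAC subrr add0r g1.
  have d0 : mdist (f t) a = 0 by have := mdist_ge0 (f t) a; lra.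
  by rewrite str d0 addr0 subrKC; exact: mdist_positivity.
- move=> u v ul vl; have [uv|vu] := leP u v.
    by rewrite mono; [rewrite ler0_norm; lra | lra | lra | lra].
  by rewrite metric_sym mono; [rewrite gtr0_norm; lra | lra | lra | lra].
Qed.

End Geodesics.

(** Equality of requests is decided classically, to make sense of [q \in I]. *)
HB.instance Definition _ (R : realType) (X : metricType R) := gen_eqMixin (request X).

Lemma count_rcons (V : Type) (p : pred V) s v : count p (rcons s v) = (count p s + p v)%N.
Proof. by rewrite -cats1 count_cat /= addn0. Qed.

(** * Appending a request to an instance *)

Section Instances.
Context {R : realType} {X : metricType R}.
Implicit Types (O : X) (q : request X) (I J : seq (request X)) (f : R -> X) (A : @algorithm R X).

Lemma is_instance_rcons I q : is_instance (rcons I q) <->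
  [/\ is_instance I, 0 <= release q, 0 < weight q &
      forall p, p \in I -> release p <= release q].
Proof.
have tr : transitive (fun p q : request X => release p <= release q).
  by move=> ? ? ?; exact: le_trans.
rewrite /is_instance all_rcons !sorted_pairwise// pairwise_rcons; split.
  move=> [/andP[/andP[r0 w0] aI] /andP[/allP rI sI]].
  by split.
move=> [[aI sI] r0 w0 rI]; rewrite r0 w0 aI sI !andbT; split=> //.
exact/allP.
Qed.

(** Strictly before its release the new request is invisible. At the release itself the two motions
    agree by continuity, so the adversary may base a request on the position at that very time. *)
Lemma online_rcons O A I q s : online O A -> is_instance (rcons I q) ->
  0 <= s -> s <= release q -> A (rcons I q) s = A I s.
Proof.
move=> [tA oA] iJ; have [iI q0 _ _] := (is_instance_rcons _ _).1 iJ.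
have before u : 0 <= u -> u < release q -> A (rcons I q) u = A I u.
  by move=> u0 uq; apply: oA => //; rewrite /released filter_rcons leNgt uq.
move=> s0; rewrite le_eqVlt => /predU1P[sq|]; last exact: before.
have [->|sn0] := eqVneq s 0; first by rewrite (tA _ iI).1 (tA _ iJ).1.
have {sn0}s0' : 0 < s by rewrite lt_neqAle eq_sym sn0.
apply/mdist_positivity/eqP; rewrite eq_le mdist_ge0 andbT.
apply/ler_addgt0Pl => e e0; rewrite addr0.
pose u := Num.max 0 (s - e / 2).
have u0 : 0 <= u by rewrite le_max lexx.
have us : u < s by rewrite gt_max s0' /=; lra.
have ue : s - e / 2 <= u by rewrite le_max lexx orbT.
have := trajectory_lip (tA _ iI) u0 (ltW us).
have := trajectory_lip (tA _ iJ) u0 (ltW us).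
rewrite before//; last by rewrite -sq.
have := metric_triangle (A (rcons I q) s) (A I u) (A I s).
by rewrite [mdist (A (rcons I q) s) (A I u)]metric_sym; lra.
Qed.

End Instances.

(** * The adversary against an online algorithm *)

Section Adversary.
Context {R : realType} {X : metricType R} (O : X).
(* With [k] requests still to come, the next one is released when the online vehicle
   is at distance [D k] from its target; if the offline vehicle rests at this target,
   it must have done so for [F k] by the time the online one could arrive there.
   The requirements on the offline vehicle are dropped unless [W] holds. *)
Context (n : nat) (T eta : R) (D F : nat -> R) (W : bool).
Context (geod : geodesic_space X) (diam : forall x y : X, mdist x y <= 2).
Context (A : @algorithm R X) (onA : online O A).
Context (a b : X) (far_ab : 2 - eta <= mdist a b).
Context (T0 : 0 <= T) (eta0 : 0 < eta) (eta1 : eta < 1).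
Context (D1 : eta < D 1) (F1 : D 1 <= F 1).
Context (DS : forall k, (0 < k)%N -> 2 * D k + 2 * eta <= D k.+1).
Context (DT : forall k, (0 < k)%N -> D k + T <= D k.+1).
Context (FS : forall k, (0 < k)%N -> F k + 2 * D k.+1 + eta <= F k.+1).
Context (Dn : forall k, (0 < k < n)%N -> D k + T + eta <= 1).
Context (Fn : forall k, W -> (0 < k < n)%N -> F k + eta <= 1).
Implicit Types (x y z : X) (q : request X) (I J : seq (request X)) (f h : R -> X).

Definition unserved q f t : Prop :=
  forall s, release q <= s <= release q + 2 -> s <= t -> f s <> site q.

(** The site can still be reached at unit speed within the window; along a trajectory this may turn
    false, but never true again. *)
Definition alive f t q : bool := t + mdist (f t) (site q) <= release q + 2.

Definition settled I t : Prop :=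
  [/\ is_instance I, sorted (fun p q => T <= release q - release p) I,
      forall q, q \in I -> weight q = 1, forall q, q \in I -> release q <= t &
      forall q, q \in I -> unserved q (A I) t].

(* An offline vehicle [h] which serves all of [I] and comes to rest in [e] at time [E]. *)
Definition planned I h (E : R) e : Prop :=
  [/\ trajectory O h, 0 <= E, forall s, E <= s -> h s = e &
      forall q, q \in I -> exists s, [/\ release q <= s <= release q + 2, s <= E & h s = site q]].

Definition adversary_wins : Prop := exists I,
  [/\ instances n T I, size I = n, forall q, q \in I -> weight q = 1,
      (count (fun q => `[< served q (A I) >]) I <= 1)%N &
      W -> exists2 h, trajectory O h & forall q, q \in I -> served q h].

Lemma eta_lt_D k : (0 < k)%N -> eta < D k.
Proof.
have [eta_gt0 eta_lt1 T_ge0] := And3 eta0 eta1 T0.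
by case: k => // k _; elim: k => // k IH; have := DS (ltn0Sn k); lra. Qed.

Lemma D_le_F k : (0 < k)%N -> D k <= F k.
Proof.
have [eta_gt0 eta_lt1 T_ge0] := And3 eta0 eta1 T0.
case: k => // k _; elim: k => // k IH; have := FS (ltn0Sn k).
by have := @eta_lt_D k.+1 isT; have := @eta_lt_D k.+2 isT; lra.
Qed.

Lemma alive_anti f s t q : trajectory O f -> 0 <= s -> s <= t ->
  alive f t q -> alive f s q.
Proof. by rewrite /alive => tf s0 st; have := trajectory_dist (site q) tf s0 st; lra. Qed.

Lemma dead_missed f t q s : trajectory O f -> 0 <= t -> ~~ alive f t q ->
  t <= s -> s <= release q + 2 -> f s <> site q.
Proof.
rewrite /alive -ltNge => tf t0 + ts sq fs; have := trajectory_dist (site q) tf t0 ts.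
by rewrite fs mdistxx; lra.
Qed.

Lemma dead_not_served f t q : trajectory O f -> 0 <= t -> unserved q f t ->
  ~~ alive f t q -> ~ served q f.
Proof.
move=> tf t0 uq dq [s sq fs]; have [st|ts] := leP s t; first exact: (uq s).
by apply: (dead_missed tf t0 dq (ltW ts)) fs; case/andP: sq.
Qed.

Lemma settled_trajectory I t : settled I t -> trajectory O (A I).
Proof. by move=> [iI _ _ _ _]; apply: onA.1. Qed.

(** Requests already out of reach cannot be served later, so only the alive ones have to be
    watched. *)
Lemma settled_later I s t : settled I s -> 0 <= s -> s <= t ->
  (forall q, q \in I -> alive (A I) s q ->
    forall u, s <= u -> u <= t -> A I u <> site q) -> settled I t.
Proof.
move=> sI s0 st away; have tI := settled_trajectory sI.
case: sI => iI gI wI rI uI; split=> // q qI.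
  by rewrite (le_trans (rI q qI)).
move=> u uq ut; have [us|su] := leP u s; first exact: uI.
have [al|de] := boolP (alive (A I) s q); first exact: away (ltW su) ut.
by apply: (dead_missed tI s0 de (ltW su)); case/andP: uq.
Qed.

Lemma settled_rcons I t z : settled I t -> 0 <= t ->
  (forall q, q \in I -> release q + T <= t) -> A I t <> z ->
  settled (rcons I (Request z t 1)) t /\
  forall s, 0 <= s -> s <= t -> A (rcons I (Request z t 1)) s = A I s.
Proof.
have [eta_gt0 eta_lt1 T_ge0] := And3 eta0 eta1 T0.
move=> [iI gI wI rI uI] t0 ready tz.
have iJ : is_instance (rcons I (Request z t 1)).
  by apply/is_instance_rcons; split=> //=; exact: ltr01.
have eqA s : 0 <= s -> s <= t -> A (rcons I (Request z t 1)) s = A I s.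
  by move=> s0 st; rewrite (online_rcons onA iJ).
have r0 q : q \in I -> 0 <= release q.
  by case: iI => /allP + _ => /[apply]/andP[].
split=> //; split=> //.
- have tr : transitive (fun p q : request X => T <= release q - release p).
    by move=> q p r; lra.
  move: gI; rewrite !sorted_pairwise// pairwise_rcons => ->; rewrite andbT.
  by apply/allP => q /ready /=; lra.
- by move=> q; rewrite mem_rcons inE => /predU1P[->//|/wI].
- by move=> q; rewrite mem_rcons inE => /predU1P[->//=|/rI].
- move=> q; rewrite mem_rcons inE => /predU1P[->/=|qI] s /=.
    move=> /andP[ts _] st; have -> : s = t by lra.
    by rewrite eqA.
  move=> sq st; rewrite eqA//; first exact: uI.
  by case/andP: sq => rs _; rewrite (le_trans (r0 q qI)).
Qed.

(** The offline vehicle knows the future: it leaves for [z] at time [E], possibly before the release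
    [t], and then waits there, whence the maximum. *)
Lemma planned_rcons I h E e z t : 0 <= t -> planned I h E e ->
  E + mdist e z <= t + 2 -> exists h',
  planned (rcons I (Request z t 1)) h' (Num.max t (E + mdist e z)) z.
Proof.
have [eta_gt0 eta_lt1 T_ge0] := And3 eta0 eta1 T0.
move=> t0 [th E0 hE hI] Et.
have [h' [th' hh' h'z]] := trajectory_goto z geod E0 th.
rewrite hE// in h'z; exists h'; split=> //.
- by rewrite le_max t0.
- by move=> s; rewrite ge_max => /andP[_ /h'z].
- move=> q; rewrite mem_rcons inE => /predU1P[->/=|/hI[s [sq sE hs]]].
    exists (Num.max t (E + mdist e z)); split=> //.
      by rewrite le_max lexx /= ge_max Et andbT; lra.
    by apply: h'z; rewrite le_max lexx orbT.
  exists s; split=> //; last by rewrite hh'.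
  by rewrite le_max; apply/orP; right; rewrite (le_trans sE)// lerDl mdist_ge0.
Qed.

Lemma wins_intro I t : settled I t -> (0 < n)%N -> size I = n ->
  (count (fun q => `[< served q (A I) >]) I <= 1)%N ->
  (W -> exists h E e, planned I h E e) -> adversary_wins.
Proof.
move=> [iI gI wI rI uI] n0 sI cI hI; exists I; split=> //.
  by split=> //; rewrite sI n0 leqnn.
move=> /hI[h [E [e [th _ _ hq]]]]; exists h => // q /hq[s [sq _ hs]].
by exists s.
Qed.

Lemma far_site p : exists x y, 2 - eta <= mdist x y /\ 2 - eta <= 2 * mdist p x.
Proof.
have [eta_gt0 eta_lt1 T_ge0] := And3 eta0 eta1 T0.
have := far_ab; have := metric_triangle a p b; rewrite [mdist a p]metric_sym => tr fab.
have [le|lt] := leP (mdist p b) (mdist p a).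
  by exists a, b; split => //; lra.
by exists b, a; split; [rewrite metric_sym | lra].
Qed.

(* The quantity [Num.max (mdist (f s) x) (mdist (f s) y) + s] is nondecreasing,
   so before it exceeds [t + 2 + eta] both sites are out of immediate reach. *)
Lemma commitment f x y t U V : trajectory O f -> 0 <= t -> 2 - eta <= mdist x y ->
  U <= mdist (f t) x -> U <= mdist (f t) y ->
  2 * V + 2 * eta <= U -> V + T <= U ->
  exists t', [/\ t + T <= t',
    forall s, t <= s -> s <= t' -> V <= mdist (f s) x /\ V <= mdist (f s) y &
    t + 2 < t' + mdist (f t') x \/ t + 2 < t' + mdist (f t') y].
Proof.
have [eta_gt0 eta_lt1 T_ge0] := And3 eta0 eta1 T0.
move=> tf t0 xy Ux Uy VU VT.
pose m (s : R) := Num.max (mdist (f s) x) (mdist (f s) y) + s.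
have mx s : mdist (f s) x <= m s - s by rewrite /m addrK le_max lexx.
have my s : mdist (f s) y <= m s - s by rewrite /m addrK le_max lexx orbT.
have mP s c : c < m s -> c < s + mdist (f s) x \/ c < s + mdist (f s) y.
  by rewrite /m -ltrBlDr lt_max => /orP[] ?; [left|right]; lra.
have mono s s' : 0 <= s -> s <= s' -> m s <= m s'.
  move=> s0 ss'; have := trajectory_dist x tf s0 ss'; have := trajectory_dist y tf s0 ss'.
  rewrite /m -lerBrDr ge_max => *; have := mx s'; have := my s'; rewrite /m.
  by move=> *; apply/andP; split; lra.
have lip s s' : t + T <= s -> s <= s' -> s' <= t + T + 3 -> `|m s' - m s| <= 2 * (s' - s).
  move=> ts ss' _; have s0 : 0 <= s by lra.
  rewrite ger0_norm; last by have := mono s s' s0 ss'; lra.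
  have hx := trajectory_dist' x tf s0 ss'; have hy := trajectory_dist' y tf s0 ss'.
  suff : m s' <= m s + 2 * (s' - s) by lra.
  rewrite {1}/m -lerBrDr ge_max; have := mx s; have := my s.
  by move=> *; apply/andP; split; lra.
have away s : t <= s -> U - (s - t) <= mdist (f s) x /\ U - (s - t) <= mdist (f s) y.
  by move=> ts; have := trajectory_dist x tf t0 ts; have := trajectory_dist y tf t0 ts; lra.
(* Either one site is already out of reach at the earliest admissible time [t + T], or one waits
   until [m] equals [t + 2 + eta]. *)
have [early|late] := leP (t + 2 + eta) (m (t + T)).
  exists (t + T); split=> // [s ts sT|]; first by have := away s ts; lra.
  by apply: mP; lra.
(* The level is reached before [t + T + 3], because [m] is at least the time and [eta < 1]. *)
have [||s [sI ms _]] := first_hit (ltr0Sn R 1) _ lip (ltW late); first lra.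
  by have := mdist_ge0 (f (t + T + 3)) x; have := mx (t + T + 3); lra.
exists s; split; [lra| |apply: mP; lra].
(* Each distance is at least [U - (u - t)]. It is also at least [(u - t) - 2 * eta], since the other
   one is at most [t + 2 + eta - u] and the sites are [2 - eta] apart. The average of the two bounds
   is at least [V]. *)
move=> u tu us; have u0 : 0 <= u by lra.
have := mono u s u0 us; have := mx u; have := my u; have := away u tu.
have := metric_triangle x (f u) y; rewrite [mdist x (f u)]metric_sym.
by move=> *; split; lra.
Qed.

(* All requests so far are lost for the online vehicle; [k] are still to come. *)
Definition restart_wins k : Prop := forall I t, settled I t -> 0 <= t ->
  (forall q, q \in I -> ~~ alive (A I) t q) ->
  (W -> exists h E e, planned I h E e) -> (size I + k)%N = n -> adversary_wins.

(* At most one request can still be served, and its site is [x]. In the two cases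
   for [e], waiting until the online vehicle is at distance [D k] from [x] gives the
   offline vehicle time to reach [y] by [t' + 2 - (F k - D k)] if the next request
   is released at time [t'] in [y]. *)
Definition pursuit_wins k : Prop := forall x y I t, 2 - eta <= mdist x y ->
  settled I t -> 0 <= t -> (forall q, q \in I -> release q + T <= t) ->
  (count (alive (A I) t) I <= 1)%N ->
  (forall q, q \in I -> alive (A I) t q -> site q = x) ->
  D k <= mdist (A I t) x ->
  (W -> exists h E e, planned I h E e /\
     ((e = x /\ E <= t + mdist (A I t) x - F k) \/
      (e = y /\ E <= t + 2 - (F k - D k)))) ->
  (size I + k)%N = n -> adversary_wins.

(** A request is released at a site [x] about 1 or more away from the online vehicle. After a delay
    [T] the distance is still at least [D k], and the pursuit begins with the offline vehicle at
    [x]. *)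
Lemma restart_step k : (k < n)%N -> ((0 < k)%N -> pursuit_wins k) -> restart_wins k.+1.
Proof.
have [eta_gt0 eta_lt1 T_ge0] := And3 eta0 eta1 T0.
move=> kn IH I t sI t0 dI pI szI; have tI := settled_trajectory sI.
(* The diameter being 2, from time [E + 2] on the offline vehicle can have reached any site by the
   release. *)
have [t1 [tt1 p1]] : exists t1, t + T <= t1 /\
    (W -> exists h E e, planned I h E e /\ E + 2 <= t1).
  case: W pI => [/(_ isT)[h [E [e hE]]]|_]; last by exists (t + T).
  exists (Num.max (t + T) (E + 2)); rewrite le_max lexx; split=> // _.
  by exists h, E, e; split=> //; rewrite le_max lexx orbT.
have tt1' : t <= t1 by lra.
have t10 : 0 <= t1 by lra.
have s1 : settled I t1.
  by apply: settled_later sI t0 tt1' _ => q qI; rewrite (negbTE (dI q qI)).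
have d1 q : q \in I -> ~~ alive (A I) t1 q.
  by move=> qI; apply: contra (dI q qI); exact: alive_anti.
have ready q : q \in I -> release q + T <= t1.
  by move=> qI; case: sI => _ _ _ /(_ q qI) + _; lra.
have [x [y [xy px]]] := far_site (A I t1).
have Ax : A I t1 <> x by move=> e; move: px; rewrite e mdistxx; lra.
have [sJ eqJ] := settled_rcons s1 t10 ready Ax.
set J := rcons I _ in sJ eqJ; have tJ := settled_trajectory sJ.
have dJ q : q \in I -> ~~ alive (A J) t1 q.
  by move=> qI; rewrite /alive eqJ//; exact: d1.
have szJ : (size J + k)%N = n by rewrite size_rcons addSnnS.
have pJ : W -> exists h E, planned J h E x /\ E = t1.
  move=> /p1[h [E [e [hE Et]]]]; have dex := diam e x.
  have [|h' ph'] := @planned_rcons I h E e x t1 t10 hE; first lra.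
  exists h', (Num.max t1 (E + mdist e x)); split=> //.
  by apply/max_idPl; lra.
have [k0|k0] := posnP k.
  apply: (wins_intro sJ); [exact: leq_ltn_trans kn | by rewrite -szJ k0 addn0 | | ].
    rewrite [count _ J]count_rcons /= (eq_in_count (a2 := pred0)) ?count_pred0; last first.
      move=> q qI /=; apply/asboolP; apply: (dead_not_served tJ t10 _ (dJ q qI)).
      by case: sJ => _ _ _ _; apply; rewrite mem_rcons inE qI orbT.
    by rewrite add0n leq_b1.
  by move=> /pJ[h [E [pE _]]]; exists h, E, x.
have := Dn (k := k); have := Fn (k := k); rewrite k0 kn => Fk Dk.
have {}Dk : D k + T + eta <= 1 by exact: Dk.
have Dk0 := eta_lt_D k0.
have tT : 0 <= t1 + T by lra.
have t1T : t1 <= t1 + T by lra.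
have away s : t1 <= s -> s <= t1 + T -> D k <= mdist (A J s) x.
  by move=> ts sT; have := trajectory_dist x tJ t10 ts; rewrite eqJ//; lra.
apply: (IH k0 x y J (t1 + T)) => //.
- apply: settled_later sJ t10 t1T _ => q; rewrite mem_rcons inE => /predU1P[->/= _|qI].
    move=> u tu uT e; have := away u tu uT; rewrite e mdistxx; lra.
  by rewrite (negbTE (dJ q qI)).
- by move=> q; rewrite mem_rcons inE => /predU1P[->//|/ready]; lra.
- rewrite [count _ J]count_rcons /= (eq_in_count (a2 := pred0)) ?count_pred0.
    by rewrite add0n leq_b1.
  move=> q qI /=; apply/negbTE; apply: contra (dJ q qI); exact: alive_anti.
- move=> q; rewrite mem_rcons inE => /predU1P[->//|qI] al.
  by have := dJ q qI; rewrite (alive_anti tJ t10 t1T al).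
- exact: away.
- move=> w; have [h [E [pE eE]]] := pJ w; exists h, E, x; split=> //; left; split=> //.
  have := Fk w isT; have := trajectory_dist x tJ t10 t1T; rewrite eqJ//; lra.
Qed.

(** Both windows close by [t + 2]. Reaching the first site takes more than [eta], and crossing to
    the other at least [2 - eta], so the two sites cannot both be served. *)
Lemma last_two I x y t : 2 - eta <= mdist x y -> settled I t -> 0 <= t ->
  (count (alive (A I) t) I <= 1)%N ->
  (forall q, q \in I -> alive (A I) t q -> site q = x) ->
  eta < mdist (A I t) x -> eta < mdist (A I t) y ->
  let J := rcons I (Request y t 1) in
  settled J t -> (forall s, 0 <= s -> s <= t -> A J s = A I s) ->
  (count (fun q => `[< served q (A J) >]) J <= 1)%N.
Proof.
have [eta_gt0 eta_lt1 T_ge0] := And3 eta0 eta1 T0.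
move=> xy sI t0 cI aI dx dy J sJ eqJ; have tJ := settled_trajectory sJ.
have rI q : q \in I -> release q <= t by case: sI => _ _ _ + _; apply.
have uJ q : q \in I -> unserved q (A J) t.
  by move=> qI; case: sJ => _ _ _ _; apply; rewrite mem_rcons inE qI orbT.
have sa q : q \in I -> served q (A J) -> alive (A I) t q.
  move=> qI sq; apply: contrapT => /negP de.
  by apply: (dead_not_served tJ t0 (uJ q qI)) sq; rewrite /alive eqJ.
rewrite [count _ J]count_rcons /=.
have [sy|] := asboolP; last first.
  rewrite addn0 => _; apply: leq_trans cI.
  rewrite (eq_in_count (a2 := fun q => (q \in I) && `[< served q (A J) >])); last by move=> q ->.
  rewrite [leqRHS](eq_in_count (a2 := fun q => (q \in I) && alive (A I) t q)); last by move=> q ->.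
  by apply: sub_count => q /andP[qI /asboolP/(sa q qI) ->]; rewrite qI.
rewrite (eq_in_count (a2 := pred0)) ?count_pred0// => q qI /=; apply/asboolP => sq.
have sx := aI q qI (sa q qI sq).
case: sq => s1 s1q f1; case: sy => s2 /= s2q f2.
have ts1 : t <= s1.
  by rewrite leNgt; apply/negP => lt; apply: (uJ q qI s1 s1q (ltW lt)).
have rq := rI q qI; rewrite sx in f1.
have ts2 : t <= s2 by lra.
have := trajectory_dist x tJ t0 ts1; have := trajectory_dist y tJ t0 ts2.
rewrite f1 f2 !mdistxx !eqJ// => h2 h1.
have [le|/ltW le] := leP s1 s2.
  by have := trajectory_lip tJ (le_trans t0 ts1) le; rewrite f1 f2; lra.
by have := trajectory_lip tJ (le_trans t0 ts2) le; rewrite f1 f2 metric_sym; lra.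
Qed.

(** If the online vehicle does not come within [D k] of [x] before [t + 3], all windows close
    unserved and a restart follows. Otherwise a request is released at [y] when the distance is
    exactly [D k], and [commitment] tells which site is lost; the other is pursued next. *)
Lemma pursuit_step k : (0 < k < n)%N -> restart_wins k ->
  ((1 < k)%N -> pursuit_wins k.-1) -> pursuit_wins k.
Proof.
have [eta_gt0 eta_lt1 T_ge0] := And3 eta0 eta1 T0.
move=> /andP[k0 kn] RW IH x y I t xy sI t0 ready cI aI Dx pI szI.
have tI := settled_trajectory sI; have Dk0 := eta_lt_D k0.
have Dk : D k + T + eta <= 1 by apply: Dn; rewrite k0.
have DFk := D_le_F k0.
have rI q : q \in I -> release q <= t by case: sI => _ _ _ + _; apply.
have stay s : 0 <= s -> t <= s -> (forall u, t <= u -> u <= s -> D k <= mdist (A I u) x) ->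
    settled I s.
  move=> s0 ts away; apply: settled_later sI t0 ts _ => q qI al u tu us e.
  by have := away u tu us; rewrite -(aI q qI al) e mdistxx; lra.
have [[s0 [ts0 s03 near]]|never] := pselect (exists s, [/\ t <= s, s <= t + 3 &
    mdist (A I s) x <= D k]); last first.
  have away u : t <= u -> u <= t + 3 -> D k < mdist (A I u) x.
    by move=> tu u3; rewrite ltNge; apply/negP => le; apply: never; exists u.
  have t3 : 0 <= t + 3 by lra.
  have tt3 : t <= t + 3 by lra.
  apply: (RW I (t + 3)) => //.
  - by apply: stay => // u tu u3; apply/ltW/away.
  - move=> q qI; apply/negP => al; have al' := alive_anti tI t0 tt3 al.
    move: al; rewrite /alive (aI q qI al').
    by have := away _ tt3 (lexx _); have := rI q qI; lra.
  - by move=> /pI[h [E [e [pE _]]]]; exists h, E, e.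
(* [first_hit] treats upward crossings, so it is applied to the opposite of the distance. *)
have lip s u : t <= s -> s <= u -> u <= s0 ->
    `|- mdist (A I u) x - - mdist (A I s) x| <= 1 * (u - s).
  move=> ts su _; have s00 : 0 <= s by lra.
  have := trajectory_dist x tI s00 su; have := trajectory_dist' x tI s00 su.
  by rewrite ler_norml => *; apply/andP; split; lra.
have [||t1 [/andP[tt1 _] /oppr_inj d1 away']] := first_hit ltr01 ts0 lip (c := - D k).
- by lra.
- by lra.
have away u : t <= u -> u <= t1 -> D k <= mdist (A I u) x.
  by move=> tu ut1; have := away' u; rewrite tu ut1 => /(_ isT); lra.
have t10 : 0 <= t1 by lra.
have s1 := stay t1 t10 tt1 away.
have ready1 q : q \in I -> release q + T <= t1 by move=> /ready; lra.
have c1 : (count (alive (A I) t1) I <= 1)%N.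
  by apply: leq_trans cI; apply: sub_count => q; exact: alive_anti.
have a1 q : q \in I -> alive (A I) t1 q -> site q = x.
  by move=> qI al; apply: aI => //; exact: alive_anti al.
have dy : 2 - eta - D k <= mdist (A I t1) y.
  by have := metric_triangle x (A I t1) y; rewrite [mdist x (A I t1)]metric_sym d1; lra.
have Ay : A I t1 <> y by move=> e; move: dy; rewrite e mdistxx; lra.
have [sJ eqJ] := settled_rcons s1 t10 ready1 Ay.
have pJ : W -> exists h E, planned (rcons I (Request y t1 1)) h E y /\
    E <= t1 + 2 - (F k - D k).
  move=> w; have Fk : F k + eta <= 1 by apply: Fn; rewrite ?k0.
  have [h [E [e [pE alt]]]] := pI w.
  (* From [x], the crossing to [y] costs at most 2, and [t + mdist (A I t) x] is at most [t1 + D k];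
     at [y], the vehicle just stays. *)
  have Ee : E + mdist e y <= t1 + 2 - (F k - D k).
    case: alt => -[-> EE]; last by rewrite mdistxx; lra.
    by have := diam x y; have := trajectory_dist x tI t0 tt1; rewrite d1; lra.
  have [|h' ph'] := @planned_rcons I h E e y t1 t10 pE; first lra.
  exists h', (Num.max t1 (E + mdist e y)); split=> //.
  by rewrite ge_max Ee andbT; lra.
have [k1|k1] := leqP k 1.
  have ke : k = 1%N by apply/eqP; rewrite eqn_leq k1.
  apply: (wins_intro sJ); [exact: leq_ltn_trans kn | by rewrite size_rcons -szI ke addn1 | | ].
    by apply: (last_two xy s1 t10 c1 a1) => //; [rewrite d1 | lra].
  by move=> /pJ[h [E [pE _]]]; exists h, E, y.
set J := rcons I _ in sJ eqJ pJ; have tJ := settled_trajectory sJ.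
have k'0 : (0 < k.-1)%N by rewrite -ltnS prednK.
have := DS k'0; have := DT k'0; have := FS k'0; rewrite prednK// => FSk DTk DSk.
have Dk'0 := eta_lt_D k'0; have DFk' := D_le_F k'0.
have Jx : D k <= mdist (A J t1) x by rewrite eqJ// d1.
have Jy : D k <= mdist (A J t1) y by rewrite eqJ//; lra.
have [t2 [t12 away2 dead2]] := commitment tJ t10 xy Jx Jy DSk DTk.
have t12' : t1 <= t2 by lra.
have t20 : 0 <= t2 by lra.
have aJ q : q \in I -> alive (A J) t1 q -> site q = x.
  by move=> qI; rewrite /alive eqJ//; exact: a1.
have s2 : settled J t2.
  apply: settled_later sJ t10 t12' _ => q; rewrite mem_rcons inE => /predU1P[->/= _|qI].
    by move=> u tu ut e; have [_] := away2 u tu ut; rewrite e mdistxx; lra.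
  move=> al u tu ut e; have [+ _] := away2 u tu ut.
  by rewrite -(aJ q qI al) e mdistxx; lra.
have ready2 q : q \in J -> release q + T <= t2.
  by rewrite mem_rcons inE => /predU1P[->//|/ready1]; lra.
have [ax ay] := away2 t2 t12' (lexx _).
have szJ : (size J + k.-1)%N = n by rewrite size_rcons addSnnS prednK.
have r1 q : q \in I -> release q <= t1 by move=> /ready1; lra.
(* If [x] is lost, the sites exchange roles and the offline vehicle already rests at the new target;
   if [y] is lost, it rests at the other site. These are the two cases for [e] in [pursuit_wins]. *)
case: dead2 => [deadx|deady].
- have dI q : q \in I -> ~~ alive (A J) t2 q.
    move=> qI; apply/negP => al; have sx := aJ q qI (alive_anti tJ t10 t12' al).
    by move: al; rewrite /alive sx; have := r1 q qI; lra.
  apply: (IH k1 y x J t2) => //; first by rewrite metric_sym.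
  + rewrite [count _ J]count_rcons /= (eq_in_count (a2 := pred0)) ?count_pred0.
      by rewrite add0n leq_b1.
    by move=> q qI; exact/negbTE/dI.
  + by move=> q; rewrite mem_rcons inE => /predU1P[->//|/dI/negbTE->].
  + move=> w; have [h [E [pE EE]]] := pJ w; exists h, E, y; split=> //; left; split=> //.
    by have := trajectory_dist y tJ t10 t12'; rewrite eqJ//; lra.
- have dy2 : alive (A J) t2 (Request y t1 1) = false.
    by rewrite /alive /=; apply/negbTE; rewrite -ltNge.
  apply: (IH k1 x y J t2) => //.
  + rewrite [count _ J]count_rcons /= dy2 addn0; apply: leq_trans c1.
    by apply: sub_count => q /(alive_anti tJ t10 t12'); rewrite /alive eqJ.
  + move=> q; rewrite mem_rcons inE => /predU1P[->|qI]; first by rewrite dy2.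
    by move=> /(alive_anti tJ t10 t12'); exact: aJ.
  + move=> w; have [h [E [pE EE]]] := pJ w; exists h, E, y; split=> //; right; split=> //.
    lra.
Qed.

(** Joint induction: a restart with [k] requests to come uses a pursuit with [k - 1], and a pursuit
    with [k] uses a restart with [k] and a pursuit with [k - 1]. *)
Lemma adversary_strategy k : (0 < k <= n)%N ->
  restart_wins k /\ ((k < n)%N -> pursuit_wins k).
Proof.
case: k => // k; elim: k => [n0|k IH kn].
  have RW : restart_wins 1 by exact: restart_step.
  by split=> // n1; apply: pursuit_step.
have [_ /(_ kn) PW] := IH (ltnW kn).
have RW : restart_wins k.+2 by exact: restart_step.
by split=> // kn'; apply: pursuit_step.
Qed.

Lemma adversary_wins_all : (0 < n)%N -> adversary_wins.
Proof.
move=> n0; have [|RW _] := @adversary_strategy n; first by rewrite n0 leqnn.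
apply: (RW [::] 0) => //.
by exists (fun _ => O), 0, O; split=> //; exact: trajectory_cst.
Qed.

End Adversary.

(** * Existence of an online algorithm that follows [GR_0] *)

Section GR0Run.
Context {R : realType} {X : metricType R} (O : X) (geod : geodesic_space X).
Implicit Types (q : request X) (I J : seq (request X)) (f g : R -> X) (i j k : nat).

Definition nthq I i : request X := nth (Request O 0 1) I i.

(* Heavier first, earlier first among equals: as instances are sorted by release,
   a newly released request never preempts a target of equal weight. *)
Definition precedes I i j : bool := (weight (nthq I j) < weight (nthq I i)) ||
  (weight (nthq I j) == weight (nthq I i)) && (i <= j)%N.

Definition is_target I f t i : Prop :=
  [/\ (i < size I)%N, pending (nthq I i) f t &
      forall j, (j < size I)%N -> pending (nthq I j) f t -> precedes I i j].

(** Approach at unit rate, stated through distances alone: unlike shortest paths, such pieces are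
    glued by mere addition. [straight_moves] recovers the path. *)
Definition straight_on I f (a b : R) : Prop :=
  forall s t, a <= s -> s <= t -> t <= b ->
  (forall i, (forall u, s <= u < t -> is_target I f u i) ->
     mdist (f s) (site (nthq I i)) = (t - s) + mdist (f t) (site (nthq I i))) /\
  ((forall u, s <= u < t -> forall i, (i < size I)%N -> ~ pending (nthq I i) f u) ->
     f t = f s).

Lemma precedes_total I : total (precedes I).
Proof. by move=> i j; rewrite /precedes; case: ltgtP => //= _; exact: leq_total. Qed.

Lemma precedes_trans I : transitive (precedes I).
Proof.
move=> j i k; rewrite /precedes => /orP[ij|/andP[/eqP ij lij]] /orP[jk|/andP[/eqP jk ljk]].
- by rewrite (lt_trans jk ij).
- by rewrite jk ij.
- by rewrite -ij jk.
- by rewrite jk ij eqxx (leq_trans lij ljk) orbT.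
Qed.

Lemma precedes_anti I i j : precedes I i j -> precedes I j i -> i = j.
Proof.
rewrite /precedes => /orP[ij|/andP[/eqP ij lij]] /orP[ji|/andP[/eqP ji lji]].
- by have := lt_trans ij ji; rewrite ltxx.
- by move: ij; rewrite ji ltxx.
- by move: ji; rewrite ij ltxx.
- by apply/eqP; rewrite eqn_leq lij.
Qed.

Lemma is_target_uniq I f t i j : is_target I f t i -> is_target I f t j -> i = j.
Proof. by move=> [li pi hi] [lj pj hj]; apply: precedes_anti (hi _ lj pj) (hj _ li pi). Qed.

Lemma is_target_ex I f t i : (i < size I)%N -> pending (nthq I i) f t ->
  exists j, is_target I f t j.
Proof.
move=> li pi; pose P := [pred j | `[< pending (nthq I j) f t >]].
have iP j : j \in [seq j <- iota 0 (size I) | P j] = (j < size I)%N && P j.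
  by rewrite mem_filter mem_iota andbC.
have := sort_sorted (precedes_total I) [seq j <- iota 0 (size I) | P j].
have mem := mem_sort (precedes I) [seq j <- iota 0 (size I) | P j].
case: (sort _ _) mem => [|j s] mem.
  by have := mem i; rewrite iP li /= in_nil => /esym/asboolP.
rewrite /= => /(order_path_min (@precedes_trans I))/allP js.
exists j; have := mem j; rewrite inE eqxx iP /= => /esym/andP[lj /asboolP pj].
split=> // k lk pk; have := mem k; rewrite iP lk /= inE.
have -> : `[< pending (nthq I k) f t >] by apply/asboolP.
move=> /predU1P[->|]; last exact: js.
by have := precedes_total I j j; rewrite orbb.
Qed.

Lemma pending_ext q f g t : (forall u, u <= t -> f u = g u) ->
  pending q f t -> pending q g t.
Proof.
by move=> fg [tq nq]; split=> // s /andP[sq st]; rewrite -fg//; apply: nq; rewrite sq.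
Qed.

Lemma is_target_ext I f g t i : (forall u, u <= t -> f u = g u) ->
  is_target I f t i -> is_target I g t i.
Proof.
move=> fg [li pi hi]; split=> //; first exact: pending_ext pi.
by move=> j lj pj; apply: hi => //; apply: pending_ext pj => u /fg.
Qed.

Lemma straight_ext I f g a b : (forall u, u <= b -> f u = g u) ->
  straight_on I f a b -> straight_on I g a b.
Proof.
move=> fg sf s t as_ st tb; have [h1 h2] := sf s t as_ st tb.
have gf u v : v < t -> u <= v -> g u = f u.
  by move=> vt uv; rewrite fg// (le_trans uv) ?(le_trans (ltW vt)).
rewrite -!fg//; last exact: le_trans tb.
split=> [i hi|hN].
  by apply: h1 => u /[dup] /hi ti /andP[_ ut]; apply: is_target_ext ti => v; exact: gf.
apply: h2 => u su i li pi; apply: (hN u su i li); case/andP: su => _ ut.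
by apply: pending_ext pi => v uv; rewrite (gf v u).
Qed.

Lemma straight_cat I f a m b : straight_on I f a m -> straight_on I f m b ->
  straight_on I f a b.
Proof.
move=> s1 s2 s t as_ st tb.
have [tm|mt] := leP t m; first exact: s1.
have [ms|sm] := leP m s; first exact: s2.
have [h1 h2] := s1 s m as_ (ltW sm) (lexx m).
have [h3 h4] := s2 m t (lexx m) (ltW mt) tb.
split=> [i hi|hN].
  rewrite h1 => [|u /andP[su um]]; last by apply: hi; rewrite su (lt_trans um).
  rewrite h3 => [|u /andP[mu ut]]; last by apply: hi; rewrite ut (le_trans (ltW sm)).
  by ring.
rewrite h4 => [|u /andP[mu ut]]; last by apply: hN; rewrite ut (le_trans (ltW sm)).
by apply: h2 => u /andP[su um]; apply: hN; rewrite su (lt_trans um).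
Qed.

Definition geo a b : R -> X := projT1 (cid (shortest_path_ex geod a b)).

Lemma geoP a b : shortest_path (geo a b) a b.
Proof. exact: projT2 (cid (shortest_path_ex geod a b)). Qed.

Definition freeze f (s : R) : R -> X := fun u => if u <= s then f u else f s.

(* The vehicle, resting from time [s] on, is sent to [q] if [q] is still pending
   just after [s]; it stops when it arrives or when [q] expires. *)
Definition pursue (fs : (R -> X) * R) q : (R -> X) * R :=
  let: (f, s) := fs in
  if `[< pending q f s >] && (s < release q + 2) then
    let e := Num.min (s + mdist (f s) (site q)) (release q + 2) in
    (fun u => if u <= s then f u else geo (f s) (site q) (Num.min u e - s), e)
  else fs.

Definition by_priority I : seq (request X) :=
  [seq nthq I i | i <- sort (precedes I) (iota 0 (size I))].

(** The sequence is reversed so that the last release is treated first: up to it the motion is the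
    one for the earlier requests, which makes the algorithm online. *)
Fixpoint GR0_rev J : R -> X :=
  if J is q :: J' then
    (foldl pursue (freeze (GR0_rev J') (release q), release q) (by_priority (rev J))).1
  else fun _ => O.

Definition GR0 I : R -> X := GR0_rev (rev I).

Lemma GR0_rcons I q : GR0 (rcons I q) =
  (foldl pursue (freeze (GR0 I) (release q), release q) (by_priority (rcons I q))).1.
Proof. by rewrite /GR0 rev_rcons /= rev_cons revK. Qed.

Lemma pursue_before L f s : forall u, u <= s -> (foldl pursue (f, s) L).1 u = f u.
Proof.
elim: L f s => // q L IH f s u us /=; case: ifP => [/andP[_ sq]|_]; last exact: IH.
rewrite IH ?us// (le_trans us)// le_min (ltW sq) andbT.
by rewrite lerDl mdist_ge0.
Qed.

Definition finished q f s : Prop :=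
  release q + 2 <= s \/ exists2 v, release q <= v <= s & f v = site q.

Lemma finished_not_pending q f s u : finished q f s -> s < u -> ~ pending q f u.
Proof.
move=> [qs|[v /andP[qv vs] fv]] su [/andP[ru uq] np]; first by lra.
by apply: (np v) fv; rewrite qv (le_trans vs (ltW su)).
Qed.

(** Invariant of the fold: each of the first [k] requests is finished or still in the priority list
    [S], so the head of [S], if pending, is the target. The other requests of [I] are released no
    earlier than [b], hence straightness is claimed only up to [b]. *)
Lemma pursueP I k b S f s : (k <= size I)%N -> 0 <= s ->
  (forall j, (k <= j < size I)%N -> b <= release (nthq I j)) ->
  (forall j, (j < k)%N -> release (nthq I j) <= s) ->
  pairwise (precedes I) S -> (forall j, j \in S -> (j < k)%N) ->
  (forall j, (j < k)%N -> finished (nthq I j) f s \/ j \in S) ->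
  trajectory O f -> (forall u, s <= u -> f u = f s) ->
  straight_on I f 0 (Num.min s b) ->
  let fs := foldl pursue (f, s) [seq nthq I i | i <- S] in
  [/\ trajectory O fs.1, 0 <= fs.2, forall u, fs.2 <= u -> fs.1 u = fs.1 fs.2,
      forall j, (j < k)%N -> finished (nthq I j) fs.1 fs.2 &
      straight_on I fs.1 0 (Num.min fs.2 b)].
Proof.
move=> kI + bI; elim: S f s => [|i S IH] f s s0 kS pS Sk fS tf zf sf /=.
  by split=> // j /fS[].
move: pS => /= /andP[/allP iS pS].
have ik : (i < k)%N by apply: Sk; rewrite inE eqxx.
have Sk' j : j \in S -> (j < k)%N by move=> jS; apply: Sk; rewrite inE jS orbT.
set q := nthq I i in fS *.
case: ifPn => [/andP[/asboolP[/andP[qs _] np] sq]|nc]; last first.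
  apply: IH => // j jk; have [fj|] := fS j jk; first by left.
  rewrite inE => /predU1P[->|jS]; [left | by right].
  move: nc; rewrite negb_and -leNgt => /orP[/asboolP np|]; last by left.
  apply: contrapT => nf; apply: np; split.
    by rewrite kS//= leNgt; apply/negP => lt; apply: nf; left; exact: ltW.
  by move=> v vs fv; apply: nf; right; exists v.
set d := mdist (f s) (site q); set e := Num.min _ _.
have d0 : 0 < d.
  by rewrite mdist_gt0; apply/eqP; apply: np; rewrite qs lexx.
have se : s < e by rewrite lt_min sq andbT ltrDl.
have ed : e <= s + d by rewrite ge_min lexx.
have eq : e <= release q + 2 by rewrite ge_min lexx orbT.
have [g0 g1 iso] := geoP (f s) (site q); rewrite -/d in g1 iso.
set p := geo _ _ in g0 g1 iso *.
set f' := fun u => _.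
have f'b u : u <= s -> f' u = f u by move=> us; rewrite /f' us.
have f'a u : s <= u -> f' u = p (Num.min u e - s).
  move=> su; rewrite /f'; case: leP => // us; have -> : u = s by lra.
  by rewrite min_l ?(ltW se)// subrr g0.
have isom u v : s <= u -> u <= v -> v <= e -> mdist (f' u) (f' v) = v - u.
  move=> su uv ve; rewrite !f'a; [|lra|lra]; rewrite !min_l; [|lra|lra].
  by rewrite iso; [rewrite ler0_norm; lra | lra | lra].
have dist u : s <= u -> u <= e -> mdist (f' u) (site q) = d - (u - s).
  move=> su ue; rewrite f'a// min_l// -g1 iso; [|lra|lra].
  by rewrite ler0_norm; lra.
have f'z u : e <= u -> f' u = f' e.
  by move=> eu; rewrite !f'a; [|lra|lra]; rewrite minxx min_r.
have tf' : trajectory O f'.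
  apply: (@trajectory_glue _ _ O f (fun u => p (Num.min u e - s))) => //.
    by rewrite min_l ?(ltW se)// subrr g0.
  move=> u v su uv; rewrite -!f'a; [|lra|lra].
  have [ve|ev] := leP v e; first by rewrite isom.
  rewrite (f'z v (ltW ev)); have [ue|eu] := leP u e; first by rewrite isom//; lra.
  by rewrite (f'z u (ltW eu)) mdistxx; lra.
have fin j : finished (nthq I j) f s -> finished (nthq I j) f' e.
  move=> [qj|[v /andP[jv vs] fv]]; [left; lra | right].
  by exists v; rewrite ?f'b// jv (le_trans vs (ltW se)).
apply: IH => //.
- by lra.
- by move=> j /kS; lra.
- move=> j jk; have [fj|] := fS j jk; first by left; exact: fin.
  rewrite inE => /predU1P[->|jS]; [left; rewrite -/q | by right].
  have [sde|esd] := leP (s + d) (release q + 2); last first.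
    by left; rewrite /e min_r// ltW.
  have ee : e = s + d by rewrite /e min_l.
  right; exists e; first by rewrite lexx andbT; lra.
  by apply: mdist_positivity; rewrite dist; lra.
have [bs|sb] := leP b s.
  rewrite min_r; last by rewrite (le_trans bs (ltW se)).
  rewrite min_r// in sf; apply: straight_ext sf => u ub.
  by rewrite f'b// (le_trans ub).
apply: (@straight_cat _ _ _ s).
  rewrite min_l ?(ltW sb)// in sf; apply: straight_ext sf => u us.
  by rewrite f'b.
(* Strictness at [s] matters: a request expiring exactly at [s] counts as finished although it may
   still be pending at that instant. *)
have tgt u : s < u -> u < e -> u < b -> is_target I f' u i.
  move=> su ue ub; split=> //; first exact: leq_trans kI.
    split=> [|v /andP[qv vu]]; first by rewrite -/q; lra.
    have [vs|sv] := leP v s; first by rewrite f'b//; apply: np; rewrite qv vs.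
    by move=> fv; have := dist v (ltW sv); rewrite fv mdistxx; lra.
  move=> j jI pj; have [jk|kj] := ltnP j k; last first.
    have := bI j; rewrite kj jI => /(_ isT) bj.
    by case: pj => /andP[ju _] _; lra.
  have [fj|] := fS j jk.
    case: (@finished_not_pending (nthq I j) f' s u _ su pj).
    case: fj => [qj|[v /andP[jv vs] fv]]; [by left | right].
    by exists v; rewrite ?f'b// jv.
  rewrite inE => /predU1P[->|]; last exact: iS.
  by have := precedes_total I i i; rewrite orbb.
move=> u v su uv; rewrite le_min => /andP[ve vb].
have [uv'|] := ltP u v; last first.
  move=> vu; have -> : v = u by lra.
  by split=> // j _; rewrite subrr add0r.
(* The midpoint avoids the endpoints, where the target may differ, and identifies any target
   constant on [[u, v)]. *)
have tm : is_target I f' ((u + v) / 2) i by apply: tgt; lra.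
have um : u <= (u + v) / 2 < v by apply/andP; split; lra.
split=> [j tj|tN].
  have -> : j = i by apply: is_target_uniq tm; exact: tj.
  by rewrite -/q !dist; lra.
by case: tm => iI pi _; case: (tN _ um i iI).
Qed.

Lemma straight_sub I f a b b' : b' <= b -> straight_on I f a b -> straight_on I f a b'.
Proof. by move=> bb sf s t as_ st tb; apply: sf => //; exact: le_trans bb. Qed.

Lemma release_mono I i j : is_instance I -> (i <= j)%N -> (j < size I)%N ->
  release (nthq I i) <= release (nthq I j).
Proof.
move=> [_ sI] ij jI; apply: (sorted_leq_nth _ _ _ sI) => //.
- by move=> ? ? ?; exact: le_trans.
- by rewrite inE (leq_ltn_trans ij).
Qed.

Lemma release_ge0 I i : is_instance I -> (i < size I)%N -> 0 <= release (nthq I i).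
Proof. by move=> [/allP aI _] iI; have /andP[] := aI _ (mem_nth (Request O 0 1) iI). Qed.

(** Induction on the number of requests taken into account; [b] bounds the time before which none of
    the remaining ones is released. *)
Lemma GR0_straight I k : is_instance I -> (k <= size I)%N ->
  trajectory O (GR0 (take k I)) /\
  forall b, (forall j, (k <= j < size I)%N -> b <= release (nthq I j)) ->
    straight_on I (GR0 (take k I)) 0 b.
Proof.
move=> iI; elim: k => [_|k IH kI].
  rewrite take0 /GR0 /=; split=> [|b bI s t s0 st tb]; first exact: trajectory_cst.
  have [st'|] := ltP s t; last first.
    move=> ts; have -> : t = s by lra.
    by split=> // j _; rewrite subrr add0r.
  split=> // j tj; have [jI [/andP[js _] _] _] := tj s ltac:(by rewrite lexx).
  by have := bI j jI; lra.
have [tI sI] := IH (ltnW kI); set q := nthq I k.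
have q0 : 0 <= release q by exact: release_ge0.
have tk : take k.+1 I = rcons (take k I) q by rewrite (take_nth (Request O 0 1)).
have nthk j : (j < k.+1)%N -> nthq (take k.+1 I) j = nthq I j.
  by move=> jk; rewrite /nthq nth_take.
have szk : size (take k.+1 I) = k.+1 by rewrite size_takel.
set S := sort (precedes (take k.+1 I)) (iota 0 k.+1).
have memS j : j \in S = (j < k.+1)%N by rewrite mem_sort mem_iota.
have byS : by_priority (take k.+1 I) = [seq nthq I i | i <- S].
  by rewrite /by_priority szk -/S; apply/eq_in_map => j; rewrite memS; exact: nthk.
have pS : pairwise (precedes I) S.
  have : pairwise (precedes (take k.+1 I)) S.
    rewrite -sorted_pairwise; last exact: precedes_trans.
    by apply: sort_sorted; exact: precedes_total.
  apply: (@sub_in_pairwise _ [pred j | (j < k.+1)%N]) => [i j ik jk|].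
    by rewrite /precedes !nthk.
  by apply/allP => j; rewrite memS.
have main b : (forall j, (k.+1 <= j < size I)%N -> b <= release (nthq I j)) ->
    trajectory O (GR0 (take k.+1 I)) /\ straight_on I (GR0 (take k.+1 I)) 0 b.
  move=> bI; rewrite {1 2}tk GR0_rcons -tk byS.
  have rk j : (j < k.+1)%N -> release (nthq I j) <= release q.
    by move=> jk; apply: release_mono.
  have fk : straight_on I (freeze (GR0 (take k I)) (release q)) 0 (Num.min (release q) b).
    apply: (@straight_sub _ _ _ (release q)); first by rewrite ge_min lexx.
    apply: straight_ext (sI (release q) _) => [u uq|j /andP[kj jI]].
      by rewrite /freeze uq.
    exact: release_mono.
  have [||||tf e0 zf ff sf] := pursueP kI q0 bI rk pS _ _ _ _ fk.
  - by move=> j; rewrite memS.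
  - by move=> j jk; right; rewrite memS.
  - exact: (trajectory_freeze q0 tI).
  - by move=> u qu; rewrite /freeze lexx; case: leP => // uq; have -> : u = release q by lra.
  set f := (foldl _ _ _).1 in tf zf ff sf *; set e := (foldl _ _ _).2 in e0 zf ff sf.
  split=> //; have [be|eb] := leP b e; first by rewrite min_r in sf.
  (* After [e] every known request is finished and the vehicle rests, with nothing pending strictly
     between [e] and [b]. *)
  rewrite min_l ?(ltW eb)// in sf; apply: straight_cat sf _ => u v eu uv vb.
  have none w i : u < w -> w < v -> (i < size I)%N -> ~ pending (nthq I i) f w.
    move=> uw wv iI'; have [ik|ki] := ltnP i k.+1.
      by apply: finished_not_pending (ff i ik) _; lra.
    by move=> [/andP[iw _] _]; have := bI i; rewrite ki iI' => /(_ isT); lra.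
  have [uv'|] := ltP u v; last first.
    move=> vu; have -> : v = u by lra.
    by split=> // j _; rewrite subrr add0r.
  split=> [i ti|_]; last by rewrite zf ?(le_trans eu)// [RHS]zf.
  have [|iI' pi _] := ti ((u + v) / 2); first by apply/andP; split; lra.
  by case: (none ((u + v) / 2) i) => //; lra.
split; last by move=> b /main[].
by have [|] := main 0 => // j /andP[_ jI]; exact: release_ge0.
Qed.

Lemma GR0_released I t : is_instance I -> GR0 I t = GR0 (released I t) t.
Proof.
elim/last_ind: I => // I q IH /is_instance_rcons[iI q0 w0 rI].
rewrite /released filter_rcons; case: ifP => qt.
  by rewrite (@all_filterP _ _ I _)//; apply/allP => p /rI pq; exact: le_trans qt.
rewrite GR0_rcons pursue_before; last by rewrite ltW// ltNge qt.
by rewrite /freeze ifT; [exact: IH | rewrite ltW// ltNge qt].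
Qed.

Lemma GR0_online : online O GR0.
Proof.
split=> [I iI|I J t iI iJ _ IJ]; last by rewrite GR0_released// [RHS]GR0_released// IJ.
by have [] := GR0_straight iI (leqnn _); rewrite take_size.
Qed.

Lemma straight_GR0_run I f : is_instance I -> trajectory O f ->
  (forall b, straight_on I f 0 b) -> GR0_run I f.
Proof.
move=> iI tf sf.
have reqE (i : 'I_(size I)) : req i = nthq I i by rewrite /req (tnth_nth (Request O 0 1)).
pose target t : option 'I_(size I) := [pick i : 'I_(size I) | `[< is_target I f t i >]].
have tgt t (i : 'I_(size I)) : target t = Some i -> is_target I f t i.
  by rewrite /target; case: pickP => // j /asboolP tj [<-].
have tgt' t (i : 'I_(size I)) : is_target I f t i -> target t = Some i.
  move=> ti; rewrite /target; case: pickP => [j /asboolP tj|/(_ i)]; last first.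
    by move=> /negP[]; apply/asboolP.
  by congr Some; apply: val_inj; exact: is_target_uniq tj ti.
have tgtN t (i : 'I_(size I)) : target t = None -> ~ pending (nthq I i) f t.
  move=> tN /(is_target_ex (ltn_ord i))[j tj]; have [jI _ _] := tj.
  by have := tgt' t (Ordinal jI) tj; rewrite tN.
have heavier i j : precedes I i j -> weight (nthq I j) <= weight (nthq I i).
  by move=> /orP[/ltW|/andP[/eqP->]].
exists target; split.
- move=> t i t0 /tgt[iI' pi hi]; rewrite /heaviest_pending !reqE; split=> // j.
  by rewrite !reqE => pj; apply: heavier; exact: hi.
- by move=> t i _ tN; rewrite reqE; exact: tgtN.
- move=> s t i s0 st /tgt[iI' pi hi] hp; apply: tgt'.
  have [pit hit] := hp t ltac:(by rewrite st lexx); rewrite reqE in pit.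
  split=> // j jI pj; have := hit (Ordinal jI); rewrite !reqE => /(_ pj) /= wji.
  rewrite /precedes; move: wji; rewrite le_eqVlt => /orP[/eqP wE|->//].
  (* A rival of equal weight either was pending at [s] already and lost the comparison then, or was
     released after [s] and has a larger index. *)
  have [js|sj] := leP (release (nthq I j)) s.
    have : pending (nthq I j) f s.
      have [/andP[_ tj] nj] := pj; split=> [|v /andP[jv vs]]; first by rewrite js (le_trans st).
      by apply: nj; rewrite jv (le_trans vs).
    by move=> /(hi j jI); rewrite /precedes.
  rewrite wE eqxx /= leqNgt; apply/orP; right; apply/negP => ji.
  have := release_mono iI (ltnW ji) iI'; have [/andP[is_ _] _] := pi.
  by lra.
- move=> s t i s0 st ht; rewrite reqE; apply: (straight_moves geod tf s0 st).
  by apply: (sf t s t s0 st (lexx t)).1 => u /ht; exact: tgt.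
- move=> s t s0 st hN; apply: (sf t s t s0 st (lexx t)).2 => u /hN uN i iI'.
  exact: (tgtN u (Ordinal iI')).
Qed.

Lemma GR0_is_GR0 : is_GR0 O GR0.
Proof.
split=> [|I iI]; first exact: GR0_online.
have [tI sI] := GR0_straight iI (leqnn _); rewrite take_size in tI sI.
apply: straight_GR0_run => // b; apply: sI => j /andP[jI].
by rewrite ltnNge jI.
Qed.

End GR0Run.

(** * Every run of [GR_0] earns at least the fraction [1 / n] *)

Section LowerBound.
Context {R : realType} {X : metricType R} (O : X).
Implicit Types (q : request X) (I : seq (request X)) (f : R -> X).

(* Among the heaviest requests, those released first: whichever of them becomes
   the target stays so until it is reached, within 2 units of time. *)
Lemma GR0_run_serves_heaviest I f : (forall x y : X, mdist x y <= 2) ->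
  is_instance I -> (0 < size I)%N -> GR0_run I f ->
  exists2 i : 'I_(size I), served (req i) f &
    forall j : 'I_(size I), weight (req j) <= weight (req i).
Proof.
move=> diam [/allP aI sI] I0 [target [t1 t2 t3 t4 _]].
have r0 (i : 'I_(size I)) : 0 <= release (req i) by have /andP[] := aI _ (mem_tnth i (in_tuple I)).
have [m _ hm] := @Order.TotalTheory.arg_maxP _ _ _ (Ordinal I0) xpredT
  (fun i : 'I_(size I) => weight (req i)) isT.
have [i /eqP iM hi] := @Order.TotalTheory.arg_minP _ _ _ m
  (fun i : 'I_(size I) => weight (req i) == weight (req m))
  (fun i => release (req i)) (eqxx _).
have hM (j : 'I_(size I)) : weight (req j) <= weight (req m) by exact: hm.
(* If [i] is not pending at its own release, the vehicle is already at its site. *)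
have [pi|npi] := pselect (pending (req i) f (release (req i))); last first.
  exists i; last by move=> j; rewrite iM.
  exists (release (req i)); first by rewrite lexx /=; lra.
  apply: contrapT => ne; apply: npi; split; first by rewrite lexx /=; lra.
  by move=> s /andP[s1 s2]; have -> : s = release (req i) by lra.
case tE : (target (release (req i))) => [j|]; last by case: (t2 _ i (r0 i) tE).
have [[/andP[ji _] pj] hj] := t1 _ _ (r0 i) tE.
have jM : weight (req j) = weight (req m).
  by apply/eqP; rewrite eq_le hM -iM hj.
(* The target [j] has been released by then, and no heaviest request is released before [i]. *)
have ij : release (req i) = release (req j).
  by apply/eqP; rewrite eq_le ji hi// jM eqxx.
exists j; last by move=> k; rewrite jM.
apply: contrapT => ns; rewrite ij in tE.
(* If [j] were never served, it would stay heaviest and pending during its whole window, hence be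
   kept as target and be reached after [d <= 2]. *)
have hp u : release (req j) <= u <= release (req j) + 2 -> heaviest_pending f u j.
  move=> ju; split=> [|k _]; last by rewrite jM.
  split=> // s /andP[js su] fs; apply: ns; exists s => //.
  by rewrite js (le_trans su)//; case/andP: ju.
have tj u : release (req j) <= u < release (req j) + 2 -> target u = Some j.
  move=> /andP[ju uj]; apply: (t3 (release (req j)) u j (r0 j) ju tE) => v /andP[jv vu].
  by apply: hp; rewrite jv; lra.
have jj2 : release (req j) <= release (req j) + 2 by lra.
have [g [_ g1 _] fg] := t4 _ _ _ (r0 j) jj2 tj.
have := diam (f (release (req j))) (site (req j)).
have := mdist_ge0 (f (release (req j))) (site (req j)).
set d := mdist _ _ in g1 * => d0 d2.
apply: ns; exists (release (req j) + d); first by apply/andP; split; lra.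
by rewrite fg; [rewrite addrC addKr | apply/andP; split; lra].
Qed.

Lemma weight_gt0 I : is_instance I -> (0 < size I)%N -> 0 < \sum_(q <- I) weight q.
Proof.
case: I => // q I [/= /andP[/andP[_ q0] /allP aI] _] _; rewrite big_cons.
rewrite ltr_pwDl// big_seq sumr_ge0// => p /aI /andP[_ /ltW].
by [].
Qed.

Lemma performance_ge0 I f : is_instance I -> 0 <= performance I f.
Proof.
move=> [/allP aI _]; rewrite /performance divr_ge0//; last first.
  by rewrite big_seq sumr_ge0// => p /aI /andP[_ /ltW].
by rewrite big_seq_cond sumr_ge0// => p /andP[/aI /andP[_ /ltW]].
Qed.

Lemma performance_le1 I f : is_instance I -> performance I f <= 1.
Proof.
move=> iI; have [/allP aI _] := iI.
case: I iI aI => [|q I] iI aI; first by rewrite /performance !big_nil mul0r ler01.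
rewrite /performance ler_pdivrMr ?mul1r ?weight_gt0// big_mkcond.
rewrite !(big_seq_cond xpredT) ler_sum// => p /andP[/aI /andP[_ /ltW p0] _].
by case: ifP.
Qed.

Lemma GR0_run_performance I f n : (forall x y : X, mdist x y <= 2) ->
  is_instance I -> (0 < size I <= n)%N -> GR0_run I f -> 1 / n%:R <= performance I f.
Proof.
move=> diam iI /andP[I0 In] run.
have [i si hi] := GR0_run_serves_heaviest diam iI I0 run.
have [/allP aI _] := iI.
have n0 : 0 < n%:R :> R by rewrite ltr0n (leq_trans I0).
have w0 : 0 <= weight (req i) by have /andP[_ /ltW] := aI _ (mem_tnth i (in_tuple I)).
have reqE (F : request X -> R) (P : pred (request X)) :
    \sum_(q <- I | P q) F q = \sum_(j < size I | P (req j)) F (req j).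
  by rewrite (big_tnth _ _ I).
rewrite /performance ler_pdivlMr ?weight_gt0// mul1r mulrC ler_pdivrMr//.
rewrite !reqE; apply: le_trans (_ : weight (req i) * n%:R <= _); last first.
  rewrite ler_pM2r// (bigD1 i) /=; last exact/asboolP.
  rewrite lerDl sumr_ge0// => j _.
  by have /andP[_ /ltW] := aI _ (mem_tnth j (in_tuple I)).
apply: le_trans (ler_sum _ (fun j _ => hi j)) _.
by rewrite sumr_const card_ord -[leLHS]mulr_natr ler_wpM2l// ler_nat.
Qed.

End LowerBound.

(** * The values of the two ratios *)

Section Values.
Context {R : realType} {X : metricType R} (O : X).
Context (geod : geodesic_space X) (diam2 : diameter X = 2%:E).
Implicit Types (A : @algorithm R X) (n k : nat) (T : R) (I : seq (request X)) (f : R -> X).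

(** With [T = 1] and no slack, the solution of [D 1 = 0], [D k.+1 = Num.max (2 * D k) (D k + 1)]. *)
Definition gap_coef k : R := if k is k'.+2 then 2 ^+ k' else 0.

Lemma le_gap_coef k m : (k <= m)%N -> gap_coef k <= gap_coef m.
Proof.
case: k m => [|[|k]] [|[|m]] //= km; rewrite ?lexx ?exprn_ge0//.
by rewrite ler_eXn2l ?ltr1n.
Qed.

(** The two conditions on [T] are, up to slack, [D n.-1 + T < 1] and [F n.-1 < 1], the tightest
    cases of [Dn] and [Fn]. *)
Lemma adversary_exists n T (W : bool) A : (0 < n)%N -> 0 <= T -> online O A ->
  T * (gap_coef n.-1 + 1) < 1 -> (W -> T * (2 ^+ n.-1 - 2) < 1) ->
  adversary_wins O n T W A.
Proof.
move=> n0 T0 onA T1 TW.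
have [m [m0 m1 mW]] : exists m : R, [/\ 0 < m, m <= 1 - T * (gap_coef n.-1 + 1) &
    W -> m <= 1 - T * (2 ^+ n.-1 - 2)].
  case: W TW => [/(_ isT) TW|_].
    exists (Num.min (1 - T * (gap_coef n.-1 + 1)) (1 - T * (2 ^+ n.-1 - 2))).
    by rewrite lt_min !ge_min lexx !subr_gt0 T1 TW; split=> // _; rewrite lexx orbT.
  by exists (1 - T * (gap_coef n.-1 + 1)); rewrite subr_gt0.
have coef0 : 0 <= gap_coef n.-1 := le_gap_coef (leq0n _).
have m_le1 : m <= 1 by have := mulr_ge0 T0 (addr_ge0 coef0 ler01); lra.
pose p : R := 2 ^+ n.-1; have p1 : 1 <= p by apply: exprn_ege1; rewrite ler1n.
(* As [2 ^+ k <= p] for [k < n], the slack terms of [D k] and [F k], with one more [e], stay below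
   [17 * p * e], the margin [m]. *)
pose e := m / (17 * p).
have p0 : 0 < 17 * p by lra.
have e0 : 0 < e by rewrite divr_gt0.
have em : 17 * (p * e) = m by rewrite /e; field; lra.
have pe : e <= p * e by rewrite ler_peMl// ltW.
have [a [b /ltW ab]] : exists a b : X, 2 - e < mdist a b.
  by apply: diameter_gt diam2 _; lra.
(* The multiples of [T] solve the recursions exactly; the multiples of [e] absorb every [eta]. *)
pose D k := gap_coef k * T + (2 ^+ k.+1 - 2) * e.
pose F k := (2 ^+ k - 2) * T + 8 * 2 ^+ k * e.
have twok k : 1 <= 2 ^+ k :> R by apply: exprn_ege1; rewrite ler1n.
have pk k : (0 < k < n)%N -> (2 : R) ^+ k <= p.
  by move=> /andP[_ kn]; rewrite /p ler_eXn2l ?ltr1n// -ltnS prednK.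
have mulT (u v : R) : u <= v -> u * T <= v * T by move=> uv; rewrite ler_wpM2r.
have mule (u v : R) : u <= v -> u * e <= v * e by move=> uv; rewrite ler_wpM2r// ltW.
apply: (@adversary_wins_all _ _ O n T e D F W geod (diameter_le diam2) A onA a b ab) => //.
- lra.
- by rewrite /D /= !exprS expr0; lra.
- by rewrite /D /F /= !exprS expr0; lra.
- case=> [//|[|k]] _; rewrite /D /= !exprS ?expr0; first lra.
  lra.
- case=> [//|[|k]] _; rewrite /D /= !exprS ?expr0; first lra.
  by have := mulT _ _ (twok k); have := mule _ _ (twok k); lra.
- case=> [//|k] _; rewrite /D /F /= !exprS; lra.
- move=> k kn; have := mule _ _ (pk k kn); rewrite /D exprS.
  have /le_gap_coef/mulT : (k <= n.-1)%N by case/andP: kn => _ kn; rewrite -ltnS prednK.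
  by lra.
- move=> k w kn; have := mule _ _ (pk k kn); have := mulT _ _ (pk k kn); have := mW w.
  by rewrite /F -/p; lra.
Qed.

Lemma performance_unit n I f : (0 < n)%N -> size I = n ->
  (forall q, q \in I -> weight q = 1) ->
  performance I f = (count (fun q => `[< served q f >]) I)%:R / n%:R.
Proof.
move=> n0 sI wI; have sumE (P : pred (request X)) :
    \sum_(q <- I | P q) weight q = (count P I)%:R.
  rewrite big_seq_cond (eq_bigr (fun=> 1)); last by move=> q /andP[/wI].
  by rewrite -big_seq_cond big_const_seq iter_addr_0.
by rewrite /performance !sumE count_predT sI.
Qed.

Lemma opt_performance_le1 I : is_instance I -> opt_performance O I <= 1.
Proof.
move=> iI; apply: ge_sup => [|_ [f _ <-]]; last exact: performance_le1.
by exists (performance I (fun _ => O)), (fun _ => O) => //; exact: trajectory_cst.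
Qed.

Lemma performance_le_opt I f : is_instance I -> trajectory O f ->
  performance I f <= opt_performance O I.
Proof.
move=> iI tf; apply: ub_le_sup; last by exists f.
by exists 1 => _ [g _ <-]; exact: performance_le1.
Qed.

Lemma opt_performance_ge0 I : is_instance I -> 0 <= opt_performance O I.
Proof.
move=> iI; apply: le_trans (performance_le_opt iI (trajectory_cst O)).
exact: performance_ge0.
Qed.

(** For [lambda] nothing is asked of an offline vehicle, hence [W] is [false] and there is a single
    condition on [T]. *)
Lemma alg_lambda_le n T A : (0 < n)%N -> 0 <= T -> online O A ->
  T * (gap_coef n.-1 + 1) < 1 -> alg_lambda (instances n T) A <= 1 / n%:R.
Proof.
move=> n0 T0 onA T1.
have [//|I [iI sI wI cI _]] := @adversary_exists n T false A n0 T0 onA T1.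
apply: (le_trans (y := performance I (A I))).
  apply: ge_inf; last by exists I.
  by exists 0 => _ [J [iJ _ _] <-]; exact: performance_ge0.
by rewrite (performance_unit _ n0 sI wI) ler_pM2r ?invr_gt0 ?ltr0n// lern1.
Qed.

Lemma alg_gamma_le n T A : (0 < n)%N -> 0 <= T -> online O A ->
  T * (gap_coef n.-1 + 1) < 1 -> T * (2 ^+ n.-1 - 2) < 1 ->
  alg_gamma O (instances n T) A <= 1 / n%:R.
Proof.
move=> n0 T0 onA T1 T2.
have [//|I [iI sI wI cI /(_ isT)[h th hI]]] := @adversary_exists n T true A n0 T0 onA T1.
have [isI _ _] := iI.
have opt1 : opt_performance O I = 1.
  apply/eqP; rewrite eq_le opt_performance_le1//=.
  apply: le_trans (performance_le_opt isI th).
  rewrite (performance_unit _ n0 sI wI) (eq_in_count (a2 := predT)); last first.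
    by move=> q /hI /asboolP ->.
  by rewrite count_predT sI divff// pnatr_eq0 -lt0n.
apply: (le_trans (y := performance I (A I) / opt_performance O I)).
  apply: ge_inf; last by exists I.
  exists 0 => _ [J [iJ _ _] <-].
  by rewrite divr_ge0 ?performance_ge0 ?opt_performance_ge0.
rewrite opt1 divr1 (performance_unit _ n0 sI wI).
by rewrite ler_pM2r ?invr_gt0 ?ltr0n// lern1.
Qed.

Lemma instances_neq0 n T : (0 < n)%N -> instances n T [:: Request O 0 1].
Proof. by move=> n0; split=> //; split=> //=; rewrite lexx ltr01. Qed.

Lemma GR0_alg_lambda n T A : (0 < n)%N -> is_GR0 O A ->
  1 / n%:R <= alg_lambda (instances n T) A.
Proof.
move=> n0 [onA runA]; apply: lb_le_inf => [|_ [I [iI sI _] <-]].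
  by eexists; exists [:: Request O 0 1]; first exact: instances_neq0.
by apply: GR0_run_performance (diameter_le diam2) iI sI (runA I iI).
Qed.

(** The optimum is positive and at most 1, so dividing by it does not lower the performance. *)
Lemma GR0_alg_gamma n T A : (0 < n)%N -> is_GR0 O A ->
  1 / n%:R <= alg_gamma O (instances n T) A.
Proof.
move=> n0 [onA runA]; apply: lb_le_inf => [|_ [I [iI sI _] <-]].
  by eexists; exists [:: Request O 0 1]; first exact: instances_neq0.
have perf := GR0_run_performance (diameter_le diam2) iI sI (runA I iI).
have perf0 : 0 < performance I (A I).
  by apply: lt_le_trans perf; rewrite divr_gt0// ltr0n.
have opt0 := lt_le_trans perf0 (performance_le_opt iI (onA.1 I iI)).
apply: (le_trans perf); rewrite ler_pdivlMr// ler_piMr ?(ltW perf0)//.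
exact: opt_performance_le1.
Qed.

Lemma lambda_eq n T : (0 < n)%N -> 0 <= T -> T * (gap_coef n.-1 + 1) < 1 ->
  lambda O (instances n T) = 1 / n%:R.
Proof.
move=> n0 T0 T1; have gr := GR0_is_GR0 O geod.
have ub : ubound [set alg_lambda (instances n T) A | A in [set A | online O A]] (1 / n%:R).
  by move=> _ [A onA <-]; exact: alg_lambda_le.
apply/eqP; rewrite eq_le; apply/andP; split.
  by apply: ge_sup ub; eexists; exists (GR0 O geod) => //; exact: GR0_online.
apply: le_trans (GR0_alg_lambda T n0 gr) _; apply: ub_le_sup; first by eexists; exact: ub.
by exists (GR0 O geod) => //; exact: GR0_online.
Qed.

Lemma gamma_eq n T : (0 < n)%N -> 0 <= T -> T * (gap_coef n.-1 + 1) < 1 ->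
  T * (2 ^+ n.-1 - 2) < 1 ->
  GR0_optimal O (instances n T) /\ gamma O (instances n T) = 1 / n%:R.
Proof.
move=> n0 T0 T1 T2; have gr := GR0_is_GR0 O geod.
have ub : ubound [set alg_gamma O (instances n T) A | A in [set A | online O A]] (1 / n%:R).
  by move=> _ [A onA <-]; exact: alg_gamma_le.
have gE : gamma O (instances n T) = 1 / n%:R.
  apply/eqP; rewrite eq_le; apply/andP; split.
    by apply: ge_sup ub; eexists; exists (GR0 O geod) => //; exact: GR0_online.
  apply: le_trans (GR0_alg_gamma T n0 gr) _; apply: ub_le_sup; first by eexists; exact: ub.
  by exists (GR0 O geod) => //; exact: GR0_online.
split=> //; split; first by exists (GR0 O geod).
move=> A grA; split; first by case: grA.
rewrite gE; apply/eqP; rewrite eq_le GR0_alg_gamma// andbT.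
by apply: alg_gamma_le => //; case: grA.
Qed.

End Values.

Theorem theorem8 (R : realType) (X : metricType R) (O : X) :
  geodesic_space X -> diameter X = 2%:E ->
  [/\ forall n : nat, (1 <= n)%N ->
        GR0_optimal O (instances n 0) /\ gamma O (instances n 0) = 1 / n%:R,
      forall (n : nat) (T : R), (1 <= n)%N ->
        0 <= T -> T < 1 / ((2 : R) ^ (n%:Z - 3) + 1) ->
        lambda O (instances n T) = 1 / n%:R &
      forall (n : nat) (T : R), (3 <= n)%N ->
        0 <= T -> T < 1 / ((2 : R) ^+ (n - 1) - 2) ->
        GR0_optimal O (instances n T) /\ gamma O (instances n T) = 1 / n%:R].
Proof.
move=> gX dX; split=> [n n0|n T n0 T0 TS|n T n3 T0 TS].
- by apply: gamma_eq; rewrite ?mul0r.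
- have e0 : 0 < (2 : R) ^ (n%:Z - 3) by rewrite exprz_gt0.
  rewrite ltr_pdivlMr in TS; last by rewrite addr_gt0.
  apply: lambda_eq => //; apply: le_lt_trans TS; apply: ler_wpM2l => //; rewrite lerD2r.
  (* For [n] equal to 1 or 2 the coefficient is 0, below the positive power; from 3 on it is exactly
     [2 ^ (n - 3)]. *)
  case: n n0 e0 => [//|[|[|n]]] _ e0 /=; [exact: ltW | exact: ltW |].
  by rewrite (_ : n.+3%:Z - 3 = n%:Z)//; lia.
- case: n n3 TS => [//|[//|[//|n]]] _; rewrite subn1 /= => TS.
  have p1 : 1 <= (2 : R) ^+ n by apply: exprn_ege1; rewrite ler1n.
  have E : (2 : R) ^+ n.+2 = 4 * 2 ^+ n by rewrite !exprS mulrA -natrM.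
  rewrite ltr_pdivlMr in TS; last by rewrite E; lra.
  (* From [n = 3] on the offline condition implies the other one:
     [2 ^+ (n - 3) + 1 <= 4 * 2 ^+ (n - 3) - 2]. *)
  apply: gamma_eq => //=; apply: le_lt_trans TS; apply: ler_wpM2l => //.
  by rewrite E; lra.
Qed.
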